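(* Let $f\colon\mathbb{R}^n\to\mathbb{R}^m$ be differentiable at $\bar x\in\mathbb{R}^n$, and let $\vartheta\colon\mathbb{R}^m\to\overline{\mathbb{R}}$ with $f(\bar x)\in\operatorname{dom}\vartheta$ be Lipschitz continuous around $f(\bar x)$ relative to its domain. If the metric subregularity qualification condition (MSQC) for $\vartheta\circ f$ is satisfied at $\bar x$ with some constant $\kappa\ge 0$, then $$\mathrm{d}(\vartheta\circ f)(\bar x)(w)=\mathrm{d}\vartheta\big(f(\bar x)\big)\big(\nabla f(\bar x)w\big)\quad\text{for all } w\in\mathbb{R}^n.$$
   Context: $\overline{\mathbb{R}}:=(-\infty,\infty]$ and $\operatorname{dom}\varphi:=\{x\mid\varphi(x)<\infty\}$. Differentiability is Fréchet differentiability, with Jacobian $\nabla f(\bar x)$. $\varphi\colon\mathbb{R}^n\to\overline{\mathbb{R}}$ is Lipschitz continuous around $\bar x\in\operatorname{dom}\varphi$ relative to a set $\Omega\subset\operatorname{dom}\varphi$ if there are $\ell\ge 0$ and a neighborhood $U$ of $\bar x$ with $|\varphi(x)-\varphi(u)|\le\ell\|x-u\|$ for all $x,u\in\Omega\cap U$ (here $\Omega$ is the domain). The subderivative of $\varphi$ at $\bar x\in\operatorname{dom}\varphi$ is $\mathrm{d}\varphi(\bar x)(\bar w):=\liminf_{t\downarrow 0,\,w\to\bar w}\frac{\varphi(\bar x+tw)-\varphi(\bar x)}{t}\in[-\infty,\infty]$. MSQC for $\vartheta\circ f$ at $\bar x$ with constant $\kappa\ge0$: there is a neighborhood $U$ of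 $\bar x$ such that $\operatorname{dist}(x;\Omega)\le\kappa\,\operatorname{dist}(f(x);\operatorname{dom}\vartheta)$ for all $x\in U$, where $\Omega:=\{x\in\mathbb{R}^n\mid f(x)\in\operatorname{dom}\vartheta\}$. *)

(* Defs.v *)
From HB Require Import structures.
From mathcomp Require Import all_boot all_order all_algebra.
From mathcomp Require Import all_classical all_reals all_analysis.
Set Implicit Arguments.
Unset Strict Implicit.
Unset Printing Implicit Defensive.
Import Order.TTheory GRing.Theory Num.Theory.
Import numFieldNormedType.Exports.
Local Open Scope classical_set_scope.
Local Open Scope ring_scope.

(* The library norm on 'rV[R]_n is the sup norm.  Distances and Lipschitz
   moduli are measured with the Euclidean norm below; neighborhoods, limits
   and Frechet differentiability use the library structure of 'rV[R]_n, which
   is the same for both norms since they are equivalent. *)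
Definition enorm (R : realType) (n : nat) (x : 'rV[R]_n) : R :=
  Num.sqrt (\sum_(i < n) x ord0 i ^+ 2).

(* An infimum in \bar R: equal to +oo when A is empty. *)
Definition edist_to (R : realType) (n : nat) (x : 'rV[R]_n)
    (A : set 'rV[R]_n) : \bar R :=
  ereal_inf [set (enorm (x - y))%:E | y in A].

Definition edom (R : realType) (n : nat) (phi : 'rV[R]_n -> \bar R) :
    set 'rV[R]_n :=
  [set x | (phi x < +oo)%E].

Definition lipschitz_around_rel (R : realType) (n : nat)
    (phi : 'rV[R]_n -> \bar R) (A : set 'rV[R]_n) (xbar : 'rV[R]_n) : Prop :=
  exists l : R, 0 <= l /\
    exists2 U : set 'rV[R]_n, nbhs xbar U &
      forall x u, (A `&` U) x -> (A `&` U) u ->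
        (`|phi x - phi u| <= (l * enorm (x - u))%:E)%E.

(* The lower limit along p = (t, w), with t -> 0, t > 0 and w -> wbar
   (the value w = wbar being allowed). *)
Definition subderivative (R : realType) (n : nat) (phi : 'rV[R]_n -> \bar R)
    (xbar wbar : 'rV[R]_n) : \bar R :=
  limf_einf
    (fun p : R * 'rV[R]_n =>
       ((phi (xbar + p.1 *: p.2)%R - phi xbar) / p.1%:E)%E)
    (filter_prod (0 : R)^'+ (nbhs wbar)).

Definition msqc (R : realType) (n m : nat) (theta : 'rV[R]_m -> \bar R)
    (f : 'rV[R]_n -> 'rV[R]_m) (xbar : 'rV[R]_n) (kappa : R) : Prop :=
  exists2 U : set 'rV[R]_n, nbhs xbar U &
    forall x, U x ->
      (edist_to x (f @^-1` edom theta)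
         <= kappa%:E * edist_to (f x) (edom theta))%E.

(* Main.v *)
Require Import Defs.
From HB Require Import structures.
From mathcomp Require Import all_boot all_order all_algebra.
From mathcomp Require Import all_classical all_reals all_analysis.
Set Implicit Arguments.
Unset Strict Implicit.
Unset Printing Implicit Defensive.
Import Order.TTheory GRing.Theory Num.Theory.
Import numFieldNormedType.Exports.
Local Open Scope classical_set_scope.
Local Open Scope ring_scope.

(** Write x for the base point, v for the image of w under the derivative of
    f, and D(t, u) = (f (x + t u) - f x) / t.  Since
    f x + t D(t, u) = f (x + t u), the difference quotient of theta \o f at
    (t, u) is the difference quotient of theta at (t, D(t, u)), and
    differentiability gives D(t, u) -> v as t decreases to 0 and u -> w
    ([cvg_diff_quot]).  So every pair near (0+, w) for the composition yields a
    pair near (0+, v) for theta with the same quotient: the lower limit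
    for theta is at most the one for theta \o f.

    The other inequality needs a converse: given (t, v') near (0+, v), find u
    near w whose quotient for theta \o f is at most the quotient of theta at
    (t, v') up to a small error.  If f x + t v' is outside the domain of theta,
    that quotient is +oo and u = w will do.  Otherwise the distance from
    f (x + t w) to the domain is at most t |D(t, w) - v'|, a small multiple of
    t, so metric subregularity provides a point x + t u of the domain of
    theta \o f whose distance to x + t w is again a small multiple of t, that is
    with u close to w ([msqc_correction]).  Now f (x + t u) and f x + t v' are
    two points of the domain of theta at distance t |D(t, u) - v'|, with D(t, u)
    and v' both close to v; the Lipschitz property bounds the difference of the two
    quotients by a multiple of |D(t, u) - v'| ([lipschitz_quotient_le]).

    Both inequalities are passed to the lower limits by
    [limf_einf_le_approx]. *)

(** * Comparison of lower limits *)

(** Every set of F is hit, with almost no larger a value of p, from all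
    points of some set of G; so the infimum of p on the former is at most that
    of q on the latter, up to e. *)
Lemma limf_einf_le_approx (R : realType) (T T' : choiceType)
    (X : filteredType T) (Y : filteredType T') (p : X -> \bar R)
    (q : Y -> \bar R) (F : set_system X) (G : set_system Y) :
  (forall (e : R) (A : set X), 0 < e -> F A ->
     \forall y \near G, exists2 x, A x & (p x <= q y + e%:E)%E) ->
  (limf_einf p F <= limf_einf q G)%E.
Proof.
move=> pq; rewrite !limf_einfE; apply: ge_ereal_sup => _ [A FA <-].
apply/lee_addgt0Pr => e e0; rewrite -leeBlDr//.
apply: le_trans; last first.
  apply: ereal_sup_ubound.
  exists [set y | exists2 x, A x & (p x <= q y + e%:E)%E]; last reflexivity.
  exact: pq.
apply: le_ereal_inf_tmp => _ [y [x Ax pxy] <-].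
rewrite leeBlDr//; apply: le_trans pxy.
by apply: ereal_inf_lbound; exists x.
Qed.

(** * Difference quotients along rays *)

Lemma subrD2l (V : zmodType) (x y z : V) : (z + x) - (z + y) = x - y.
Proof. by rewrite [z + x]addrC addrKA. Qed.

Lemma near_fst_gt0 (R : realFieldType) (T : Type) (F : set_system T) :
  Filter F -> \forall p \near filter_prod (0 : R)^'+ F, 0 < p.1.
Proof. by move=> FF; have := @cvg_fst _ _ _ F FF _ (nbhs_right_gt (0 : R)). Qed.

Lemma cvg_ray (R : realFieldType) (V : normedModType R) (x w : V) :
  x + p.1 *: p.2 @[p --> filter_prod (0 : R)^'+ (nbhs w)] --> x.
Proof.
rewrite -[X in _ --> X]addr0 -(scale0r w).
apply: cvgD; first exact: cvg_cst.
apply: cvgZ; last exact: cvg_snd.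
by apply: cvg_trans (cvg_within _); exact: cvg_fst.
Qed.

Lemma near_snd_dist_lt (R : realFieldType) (V : normedModType R) (w : V)
    (c : R) : 0 < c ->
  \forall p \near filter_prod (0 : R)^'+ (nbhs w), `|w - p.2| < c.
Proof.
suff /cvgr_dist_lt : p.2 @[p --> filter_prod (0 : R)^'+ (nbhs w)] --> w.
  by apply.
exact: cvg_snd.
Qed.

Definition diff_quot (R : realFieldType) (V W : normedModType R) (f : V -> W)
    (x : V) (p : R * V) : W := p.1^-1 *: (f (x + p.1 *: p.2) - f x).

Lemma diff_quotK (R : realFieldType) (V W : normedModType R) (f : V -> W)
    (x u : V) (t : R) :
  0 < t -> f x + t *: diff_quot f x (t, u) = f (x + t *: u).
Proof.
move=> t0; rewrite /diff_quot/= scalerA divff ?gt_eqF// scale1r.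
by rewrite addrC subrK.
Qed.

(** Letting the direction vary costs nothing: the Frechet remainder is
    o(|t u|), and u stays bounded near w. *)
Lemma cvg_diff_quot (R : realFieldType) (V W : normedModType R)
    (f : V -> W) (x w : V) : differentiable f x ->
  diff_quot f x p
    @[p --> filter_prod (0 : R)^'+ (nbhs w)] --> 'd f x w.
Proof.
move=> dfx; pose r h : W := f (h + x) - (f x + 'd f x h).
have ro c : 0 < c -> \forall h \near (0 : V), `|r h| <= c * `|h|.
  by move: c; have /eqaddoP := diff_locally dfx.
suff : 'd f x p.2 + p.1^-1 *: r (p.1 *: p.2)
    @[p --> filter_prod (0 : R)^'+ (nbhs w)] --> 'd f x w + 0.
  rewrite addr0; apply: cvg_trans; apply: near_eq_cvg; near=> p.
  have p0 : 0 < p.1 by near: p; exact: near_fst_gt0.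
  rewrite /r /diff_quot [x + _]addrC opprD addrA scalerBr.
  rewrite [X in _ - _ *: X]linearZ/=.
  by rewrite scalerA mulVf ?scale1r ?gt_eqF// [LHS]addrC subrK.
apply: cvgD.
  apply: (@cvg_comp _ _ _ snd ('d f x)); first exact: cvg_snd.
  exact: diff_continuous.
apply/cvgr0Pnorm_le => e e0.
(* Near w the norm of the direction is at most |w| + 1, so a remainder of
   at most e / (|w| + 1) times the norm of t u is at most e t. *)
have c0 : 0 < e / (`|w| + 1) by rewrite divr_gt0// ltr_wpDl.
near=> p.
have p0 : 0 < p.1 by near: p; exact: near_fst_gt0.
have pw : `|p.2| <= `|w| + 1.
  have : `|w - p.2| < 1 by near: p; exact: near_snd_dist_lt.
  rewrite distrC => /ltW wp; rewrite -[p.2](subrK w) addrC.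
  by rewrite (le_trans (ler_normD _ _))// lerD2l.
rewrite normrZ normfV gtr0_norm// ler_pdivrMl//.
apply: (@le_trans _ _ (e / (`|w| + 1) * `|p.1 *: p.2|)).
  near: p.
  have := @cvg_ray _ _ 0 w _ (ro _ c0).
  by under eq_fun do rewrite add0r.
rewrite normrZ gtr0_norm// mulrCA ler_wpM2l ?(ltW p0)//.
by rewrite mulrAC ler_pdivrMr ?ltr_wpDl// ler_wpM2l ?(ltW e0).
Unshelve. all: by end_near. Qed.

(** * Euclidean and sup norms *)

(** [enorm_le] and [norm_le_enorm] are the two halves of the equivalence
    between the Euclidean norm and the sup norm; only the order of magnitude
    matters, so the constant n stands in for its square root. *)
Lemma enorm_le (R : realType) (n : nat) (x : 'rV[R]_n) :
  enorm x <= n%:R * `|x|.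
Proof.
have n0 : 0 <= n%:R * `|x| by rewrite mulr_ge0.
rewrite /enorm -[leRHS]ger0_norm// -sqrtr_sqr ler_wsqrtr// exprMn.
apply: (@le_trans _ _ (\sum_(i < n) `|x| ^+ 2)).
  apply: ler_sum => i _; rewrite -real_normK ?num_real//.
  rewrite ler_sqr ?nnegrE//.
  rewrite [leRHS](mx_normrE x).
  exact: (le_bigmax _ _ (ord0, i)).
rewrite sumr_const card_ord -[leLHS]mulr_natl ler_wpM2r ?exprn_ge0//.
by rewrite -natrX ler_nat; case: n {x n0} => // n;
  rewrite expnS leq_pmulr ?expn_gt0.
Qed.

Lemma norm_le_enorm (R : realType) (n : nat) (x : 'rV[R]_n) : `|x| <= enorm x.
Proof.
have [->|/mx_norm_neq0[[i j] /= xE]] := eqVneq `|x| 0.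
  exact: sqrtr_ge0.
rewrite [leLHS]xE -sqrtr_sqr ler_wsqrtr// (bigD1 j)//= (ord1 i).
by rewrite lerDl sumr_ge0// => k _; rewrite sqr_ge0.
Qed.

(** * Metric subregularity and Lipschitz continuity along rays *)

Lemma edom_fin_num (R : realType) (n : nat) (phi : 'rV[R]_n -> \bar R)
    (y : 'rV[R]_n) :
  (forall z, (-oo < phi z)%E) -> edom phi y -> phi y \is a fin_num.
Proof. by move=> phi_gtNy phiy; rewrite fin_numElt phi_gtNy. Qed.

(** This is where metric subregularity enters.  A point of the domain of theta on
    a ray through f x need not be a value of f, but it lies within t |D(t, w) - v'|
    of f (x + t w); the qualification condition trades this for a displacement
    of x + t w itself, and dividing by t gives the correction of w. *)
Lemma msqc_correction (R : realType) (n m : nat) (f : 'rV[R]_n -> 'rV[R]_m)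
    (xbar w : 'rV[R]_n) (theta : 'rV[R]_m -> \bar R) (kappa : R)
    (Q : set 'rV[R]_n) :
  differentiable f xbar -> 0 <= kappa -> msqc theta f xbar kappa ->
  nbhs w Q ->
  \forall p \near filter_prod (0 : R)^'+ (nbhs ('d f xbar w)),
    edom theta (f xbar + p.1 *: p.2) ->
    exists2 u, Q u & edom theta (f (xbar + p.1 *: u)).
Proof.
move=> dfx kappa_ge0 [N Nx msqcN] /nbhs_ballP[r /= r0 rQ].
set v := 'd f xbar w.
have cvg_w : (p.1, w) @[p --> filter_prod (0 : R)^'+ (nbhs v)] -->
    filter_prod (0 : R)^'+ (nbhs w).
  move=> B [[P1 Q1]/= [P10 Q1w] PQB]; exists (P1, setT) => /=.
    by split=> //; exact: filterT.
  by move=> [t u] [/= Pt _]; apply: PQB; split=> //=; exact: nbhs_singleton.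
have Dw_cvg :
    diff_quot f xbar (p.1, w) @[p --> filter_prod (0 : R)^'+ (nbhs v)] --> v.
  exact: (cvg_comp _ _ cvg_w (cvg_diff_quot dfx)).
have km0 : 0 <= kappa * m%:R by rewrite mulr_ge0.
(* The correction of w has size at most kappa * m * eta; adding 1 to the
   denominator makes this smaller than r even when kappa * m = 0. *)
pose eta := r / (kappa * m%:R + 1).
have eta0 : 0 < eta by rewrite divr_gt0// ltr_wpDl.
near=> p => dom_p.
have p0 : 0 < p.1 by near: p; exact: near_fst_gt0.
have Dw : `|diff_quot f xbar (p.1, w) - p.2| < eta.
  rewrite -(subrKA v) (le_lt_trans (ler_normD _ _))// (splitr eta) ltrD//.
    rewrite distrC; near: p; move/cvgr_dist_lt : Dw_cvg; apply.
    exact: divr_gt0.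
  by near: p; apply: near_snd_dist_lt; exact: divr_gt0.
have dist_lt : (edist_to (xbar + p.1 *: w) (f @^-1` edom theta) <
    (r * p.1)%:E)%E.
  have Npw : N (xbar + p.1 *: w).
    near: p; exact: (cvg_comp _ _ cvg_w (@cvg_ray _ _ xbar w)).
  apply: le_lt_trans (msqcN _ Npw) _.
  apply: (@le_lt_trans _ _ (kappa%:E *
     (enorm (f (xbar + p.1 *: w) - (f xbar + p.1 *: p.2)))%:E)%E).
    apply: lee_wpmul2l; first by rewrite lee_fin.
    by apply: ereal_inf_lbound; exists (f xbar + p.1 *: p.2).
  rewrite -EFinM lte_fin -diff_quotK// subrD2l -scalerBr.
  apply: (@le_lt_trans _ _
    (kappa * (m%:R * `|p.1 *: (diff_quot f xbar (p.1, w) - p.2)|))).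
    by rewrite ler_wpM2l// enorm_le.
  rewrite normrZ gtr0_norm// [p.1 * _]mulrC !mulrA ltr_pM2r//.
  apply: (@le_lt_trans _ _ (kappa * m%:R * eta)).
    by rewrite ler_wpM2l// ltW.
  by rewrite /eta mulrCA gtr_pMr// ltr_pdivrMr ?ltr_wpDl// mul1r ltrDl.
have [_ [y ydom <-]] := ereal_inf_lt dist_lt.
rewrite lte_fin => xy_lt.
pose u := p.1^-1 *: (y - xbar).
have yE : xbar + p.1 *: u = y.
  by rewrite scalerA divff ?gt_eqF// scale1r addrC subrK.
exists u; last by rewrite yE.
apply: rQ; rewrite -ball_normE /ball_/= -(ltr_pM2r p0).
apply: (le_lt_trans _ xy_lt); apply: (le_trans _ (norm_le_enorm _)).
by rewrite -yE subrD2l -scalerBr normrZ gtr0_norm// mulrC.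
Unshelve. all: by end_near. Qed.

Lemma lipschitz_quotient_le (R : realType) (m : nat)
    (theta : 'rV[R]_m -> \bar R) (z a b : 'rV[R]_m) (l t : R) :
  (forall y, (-oo < theta y)%E) -> edom theta z ->
  edom theta (z + t *: a) -> edom theta (z + t *: b) -> 0 <= l -> 0 < t ->
  (`|theta (z + t *: a)%R - theta (z + t *: b)%R| <=
    (l * enorm ((z + t *: a) - (z + t *: b)))%:E)%E ->
  ((theta (z + t *: a)%R - theta z) / t%:E <=
    (theta (z + t *: b)%R - theta z) / t%:E + (l * m%:R * `|a - b|)%:E)%E.
Proof.
move=> gtNy zdom adom bdom l0 t0.
move: (edom_fin_num gtNy adom) (edom_fin_num gtNy bdom).
move: (edom_fin_num gtNy zdom).
case: (theta z) => // c _; case: (theta (z + t *: a)) => // ya _.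
case: (theta (z + t *: b)) => // yb _.
rewrite -!EFinB inver gt_eqF// -!EFinM -EFinD !lee_fin subrD2l -scalerBr.
move=> ab; rewrite -lerBlDl -mulrBl opprB subrKA ler_pdivrMr//.
apply: (le_trans (ler_norm _)); apply: (le_trans ab).
apply: (@le_trans _ _ (l * (m%:R * `|t *: (a - b)|))).
  by rewrite ler_wpM2l// enorm_le.
by rewrite normrZ gtr0_norm// [t * _]mulrC !mulrA.
Qed.

(** * The chain rule *)

(** The easy inequality: substituting (t, D(t, u)) for (t, u) turns the
    quotients of the composition into quotients of theta. *)
Lemma subderivative_comp_ge (R : realType) (n m : nat)
    (f : 'rV[R]_n -> 'rV[R]_m) (xbar w : 'rV[R]_n)
    (theta : 'rV[R]_m -> \bar R) :
  differentiable f xbar ->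
  (subderivative theta (f xbar) ('d f xbar w) <=
    subderivative (theta \o f) xbar w)%E.
Proof.
move=> dfx; apply: limf_einf_le_approx => e A e0 [[P Q]/= [P0 Qv] PQA].
near=> p.
have p0 : 0 < p.1 by near: p; exact: near_fst_gt0.
exists (p.1, diff_quot f xbar p).
  apply: PQA; split=> /=; first by near: p; exact: cvg_fst.
  by near: p; exact: (cvg_diff_quot dfx).
rewrite /= [X in diff_quot _ _ X]surjective_pairing diff_quotK//.
by rewrite leeDl// lee_fin ltW.
Unshelve. all: by end_near. Qed.

(** The inequality that needs the qualification condition: off the domain the
    quotient of theta is +oo, and on it [msqc_correction] moves w to a direction
    whose quotient is compared by [lipschitz_quotient_le]. *)
Lemma subderivative_comp_le (R : realType) (n m : nat)
    (f : 'rV[R]_n -> 'rV[R]_m) (xbar w : 'rV[R]_n)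
    (theta : 'rV[R]_m -> \bar R) (kappa : R) :
  differentiable f xbar -> (forall y, (-oo < theta y)%E) ->
  edom theta (f xbar) ->
  lipschitz_around_rel theta (edom theta) (f xbar) ->
  0 <= kappa -> msqc theta f xbar kappa ->
  (subderivative (theta \o f) xbar w <=
    subderivative theta (f xbar) ('d f xbar w))%E.
Proof.
move=> dfx gtNy fxbar_dom [l [l0 [U Uf lipU]]] kappa_ge0 msqc_f.
set v := 'd f xbar w.
apply: limf_einf_le_approx => e A e0 FA.
(* Both D(t, u) and v' are kept within rho of v, which makes the Lipschitz
   error at most l * m * (2 * rho) <= e. *)
pose rho := e / 2 / (l * m%:R + 1).
have lm0 : 0 <= l * m%:R by rewrite mulr_ge0.
have rho0 : 0 < rho by rewrite !divr_gt0// ltr_wpDl.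
have : filter_prod (0 : R)^'+ (nbhs w)
    (A `&` [set p | `|v - diff_quot f xbar p| < rho]
       `&` [set p | U (f (xbar + p.1 *: p.2))]).
  apply: filterI; first apply: filterI => //.
    by move/cvgr_dist_lt : (cvg_diff_quot (w := w) dfx); exact.
  exact: (@cvg_ray _ _ xbar w _ (differentiable_continuous dfx Uf)).
move=> [[P Q]/= [P0 Qw] PQA].
near=> p.
have p0 : 0 < p.1 by near: p; exact: near_fst_gt0.
have Pp : P p.1 by near: p; exact: cvg_fst.
have [dom_p|ndom_p] := pselect (edom theta (f xbar + p.1 *: p.2)); last first.
  exists (p.1, w).
    have /PQA[[]// ] : (P `*` Q) (p.1, w).
    by split => //=; exact: nbhs_singleton.
  have -> : theta (f xbar + p.1 *: p.2) = +oo%E.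
    by apply/eqP; rewrite -leye_eq leNgt; apply/negP.
  have := edom_fin_num gtNy fxbar_dom.
  case: (theta (f xbar)) => // c _.
  rewrite addye// inver gt_eqF// gt0_mulye ?lte_fin ?invr_gt0//.
  by rewrite addye// leey.
have [u Qu udom] : exists2 u, Q u & edom theta (f (xbar + p.1 *: u)).
  by move: dom_p; near: p; exact: (msqc_correction dfx kappa_ge0 msqc_f Qw).
have [[Au Du] Uu] : (A `&` [set p | `|v - diff_quot f xbar p| < rho]
    `&` [set p | U (f (xbar + p.1 *: p.2))]) (p.1, u).
  by apply: PQA; split.
rewrite /= in Du Uu.
have Up : U (f xbar + p.1 *: p.2).
  by near: p; exact: (@cvg_ray _ _ (f xbar) v).
have vp : `|v - p.2| < rho by near: p; exact: near_snd_dist_lt.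
exists (p.1, u) => //=.
have := lipU _ _ (conj udom Uu) (conj dom_p Up).
rewrite -diff_quotK// in udom *.
move=> /(lipschitz_quotient_le gtNy fxbar_dom udom dom_p l0 p0).
move=> /le_trans; apply; rewrite leeD2l// lee_fin.
apply: (@le_trans _ _ (l * m%:R * (rho + rho))).
  rewrite ler_wpM2l// -(subrKA v) (le_trans (ler_normD _ _))//.
  by rewrite lerD// ltW// distrC.
rewrite /rho -mulrDl -splitr mulrCA ger_pMr// ler_pdivrMr ?ltr_wpDl//.
by rewrite mul1r lerDl.
Unshelve. all: by end_near. Qed.

(* Vectors are rows, so the Jacobian acts on the right. *)
Theorem theorem3p4 (R : realType) (n m : nat)
    (f : 'rV[R]_n -> 'rV[R]_m) (xbar : 'rV[R]_n)
    (theta : 'rV[R]_m -> \bar R) (kappa : R)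
    (df : differentiable f xbar)
    (theta_gtNy : forall y, (-oo < theta y)%E)
    (fxbar_dom : edom theta (f xbar))
    (theta_lip : lipschitz_around_rel theta (edom theta) (f xbar))
    (kappa_ge0 : 0 <= kappa)
    (theta_f_msqc : msqc theta f xbar kappa) :
  forall w : 'rV[R]_n,
    subderivative (theta \o f) xbar w =
    subderivative theta (f xbar) (w *m 'J f xbar).
Proof.
move=> w; have -> : w *m 'J f xbar = 'd f xbar w by exact: mul_rV_lin1.
apply/le_anti/andP; split; last exact: subderivative_comp_ge df.
exact: (subderivative_comp_le w df theta_gtNy fxbar_dom theta_lip kappa_ge0
  theta_f_msqc).
Qed.
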